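(* Fix integers $n,t,\lambda$ with $0\le t<n$ and $\lambda\ge 1$. There exists $q_0=q_0(n,t,\lambda)$ such that, for every prime power $q\geq q_0$ and every $t$-$(q,n,\lambda)$ orthogonal array $D\subseteq X=\mathbb{F}_q^n$, $$\operatorname{span}_{\mathbb{C}}\{g\boldsymbol{1}_D\mid g\in G\}=U_0\oplus U_{t+1}\oplus U_{t+2}\oplus\cdots\oplus U_n,$$ where $G=\mathfrak{S}_q\wr\mathfrak{S}_n$ and $U_j=\operatorname{span}_{\mathbb{C}}\{\chi_\eta\mid\eta\in X,\ \operatorname{wt}(\eta)=j\}$ for $0\le j\le n$. In particular, $$\dim_{\mathbb{Q}}\operatorname{span}_{\mathbb{Q}}\{g\boldsymbol{1}_D\mid g\in G\}=q^n-\sum_{j=1}^{t}\binom{n}{j}(q-1)^j.$$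
   Context: Let $A=\mathbb{F}_q$ and $X=A^n$. A $t$-$(q,n,\lambda)$ orthogonal array (a $t$-design of index $\lambda$ in the Hamming scheme $H(n,q)$) is a non-empty subset $D\subseteq X$ (no repeated elements) such that, in any fixed $t$ coordinate positions, every $t$-tuple in $A^t$ appears in exactly $\lambda$ elements of $D$. $\boldsymbol{1}_D\in\mathbb{C}^X$ is the characteristic vector of $D$. The wreath product $G=\mathfrak{S}_q\wr\mathfrak{S}_n$ acts on $X=A^n$ by permuting the $n$ coordinates and applying an arbitrary permutation of $A$ in each coordinate independently; it acts on $\mathbb{C}^X$ by $g\boldsymbol{1}_D=\boldsymbol{1}_{gD}$. Fix a non-trivial additive character $\psi:\mathbb{F}_q\to\mathbb{C}^\times$. For $\eta=(\eta_1,\dots,\eta_n)\in X$ let $\chi_\eta(x)=\psi(\langle\eta,x\rangle)$ for $x\in X$, where $\langle\eta,x\rangle=\sum_i\eta_ix_i$, and $\operatorname{wt}(\eta)=\#\{i:\eta_i\ne 0\}$. *)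

(* Defs.v *)
From HB Require Import structures.
From mathcomp Require Import all_boot all_order all_fingroup all_algebra.
From mathcomp Require Import reals.
From mathcomp Require Import complex.

Set Implicit Arguments.
Unset Strict Implicit.
Unset Printing Implicit Defensive.

Import GRing.Theory.
Local Open Scope ring_scope.

Notation word n A := {ffun 'I_n -> A}.

(* Each t-tuple of A^t occurs in exactly lambda words of D, at any t distinct
   positions; the order in which the positions are listed is immaterial. *)
Definition orthogonal_array (n t lambda : nat) (A : finType)
    (D : {set word n A}) : Prop :=
  D != set0 /\
  forall pos : t.-tuple 'I_n, uniq pos -> forall a : t.-tuple A,
    #|[set x in D | [forall k, x (tnth pos k) == tnth a k]]| = lambda.

Section Wreath.

Variables (n : nat) (A : finType).

Definition wreath_fun (s : 'S_n) (p : {ffun 'I_n -> {perm A}})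
    (x : word n A) : word n A := [ffun i => p i (x (s i))].

Lemma wreath_fun_inj s p : injective (wreath_fun s p).
Proof.
move=> x y /ffunP exy; apply/ffunP=> i.
by have := exy (s^-1 i)%g; rewrite !ffunE permKV => /perm_inj.
Qed.

Definition wreath_perm s p : {perm word n A} := perm (@wreath_fun_inj s p).

(* The wreath product Sym(A) wr S_n, realised as the permutation group on A^n
   given by its action; this action is faithful as soon as #|A| > 1. *)
Definition wreath : {set {perm word n A}} :=
  [set wreath_perm s p | s in [set: 'S_n],
                         p in [set: {ffun 'I_n -> {perm A}}]].

Lemma wreath_group_set : group_set wreath.
Proof.
apply/group_setP; split.
  apply/imset2P; exists 1%g [ffun=> 1%g]; rewrite ?inE //.
  by apply/permP=> x; rewrite perm1 permE; apply/ffunP=> i;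
    rewrite !ffunE !perm1.
move=> _ _ /imset2P[s p _ _ ->] /imset2P[s' p' _ _ ->].
apply/imset2P; exists (s' * s)%g [ffun i => p (s' i) * p' i]%g;
  rewrite ?inE //.
by apply/permP=> x; rewrite permM !permE; apply/ffunP=> i;
  rewrite !ffunE !permM.
Qed.

Canonical wreath_group := Group wreath_group_set.

End Wreath.

Section FunctionSpace.

Variables (K : fieldType) (X : finType).

Definition char_vec (D : {set X}) : {ffun X -> K^o} :=
  [ffun x => (x \in D)%:R].

Definition fun_act (g : {perm X}) (f : {ffun X -> K^o}) : {ffun X -> K^o} :=
  [ffun x => f (g^-1 x)%g].

Lemma fun_act_char_vec g (D : {set X}) :
  fun_act g (char_vec D) = char_vec (g @: D).
Proof.
apply/ffunP=> x; rewrite !ffunE.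
by rewrite -{2}(permKV g x) (mem_imset _ _ (@perm_inj _ g)).
Qed.

Definition orbit_span (G : {set {perm X}}) (D : {set X}) :
    {vspace {ffun X -> K^o}} :=
  <<[seq fun_act g (char_vec D) | g in G]>>%VS.

End FunctionSpace.

Section Characters.

Variables (F : finFieldType) (K : fieldType).

Definition additive_character (psi : F -> K) : Prop :=
  (forall x, psi x != 0) /\ {morph psi : x y / x + y >-> x * y}.

Definition nontrivial (psi : F -> K) : Prop := exists x, psi x != 1.

Variable n : nat.

Definition wt (eta : word n F) : nat := #|[set i | eta i != 0]|.

Definition dotp (eta x : word n F) : F := \sum_i eta i * x i.

Definition chi (psi : F -> K) (eta : word n F) : {ffun word n F -> K^o} :=
  [ffun x => psi (dotp eta x)].

Definition weight_space (psi : F -> K) (j : nat) :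
    {vspace {ffun word n F -> K^o}} :=
  <<[seq chi psi eta | eta in [set eta | wt eta == j]]>>%VS.

End Characters.

(* Main.v *)
Require Import Defs.
From HB Require Import structures.
From mathcomp Require Import all_boot all_order all_fingroup all_algebra.
From mathcomp Require Import reals.
From mathcomp Require Import complex.
From mathcomp Require Import ring.

Set Implicit Arguments.
Unset Strict Implicit.
Unset Printing Implicit Defensive.

Import Order.TTheory GRing.Theory Num.Theory.
Local Open Scope ring_scope.

(** Write q for the size of the alphabet A.  The functions on A split into the
    constants and the functions of sum zero, and tensoring over the n
    coordinates splits the functions on A^n into pieces V_J indexed by the sets
    J of coordinates: V_J consists of the functions of the coordinates in J
    that sum to zero along each of them.  It is spanned by the zonal functions

      zonal J b x = \prod_(i in J) (q [x_i = b_i] - 1),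

    which are, up to a scalar, the orthogonal projections on V_J of the point
    masses at the words b.  Everything is done with these functions, over an
    arbitrary numeric field, so that the rational and the complex claims have
    the same proof.

    - The orbit of 1_D spans the sum of those V_J to which some vector of the
      orbit is not orthogonal.  The reason is that the permutation matrices of A span, among other
      things, the all-one matrix and the matrices with entries
      (q [u = b] - 1) (q [v = y] - 1) (perm_combination_rank1); a tensor product
      of combinations of permutations is a combination of elements of the
      wreath product (tensor_orbit_span), and the tensor product of the matrices
      just mentioned sends 1_D to the multiple of zonal J b by the scalar
      product of zonal J y with 1_D (zonal_orbit_span).  Conversely, a function
      orthogonal to V_J for every J outside P lies in the sum of the V_J with J
      in P, because the zonal functions resolve the identity
      (zonal_space_ortho).

    - For an orthogonal array D the sum over D of a function of t coordinates is
      a fixed multiple of its sum over all words (oa_exact), so that the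
      projections on V_J vanish for 1 <= |J| <= t (sum_oa_zonal0).  If |J| > t
      and y is in D, expand the product defining zonal J y as a sum over the
      subsets S of J, in terms of the numbers f_S of words of D that agree with
      y on S.  The subset S = J contributes at least q^|J|, while the property
      of orthogonal arrays gives q^|S| f_S <= lambda q^(|J|-1) for each of the
      2^|J| - 1 others.  Hence the sum is positive as soon as
      q >= 2^n lambda (sum_oa_zonal_gt0), which is the bound q_0 used here.

    - Over the alphabet F, the dimension of a sum of spaces V_J is the number of
      words eta whose support is one of the sets J (dim_zonal_space): this
      number is an upper bound because the zonal J eta with supp eta = J already
      span V_J, and the upper bounds for all the sets J add up to the dimension
      of the whole space.  Counting words by weight gives the dimension formula.

    - Expanding q [a = 0] - 1 as the sum of psi (c a) over c != 0 writes
      zonal J b in terms of the characters with support J; comparing dimensions,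
      U_j is the sum of the V_J with |J| = j (weight_space_zonal), and the sum of
      the U_j is direct, again for reasons of dimension. *)

(** * Linear combinations of permutation matrices *)

Section PermCombinations.

Variables (K : numFieldType) (A : finType).
Implicit Types (t : A -> A -> K) (u v y b : A).

Let q : K := #|A|%:R.

Definition perm_combination t : Prop :=
  exists c : {perm A} -> K, forall u v, t u v = \sum_s c s * (s u == v)%:R.

Lemma eq_perm_combination t t' :
  (forall u v, t u v = t' u v) -> perm_combination t' -> perm_combination t.
Proof. by move=> e [c ct]; exists c => u v; rewrite e ct. Qed.

Lemma perm_combination_perm (s : {perm A}) :
  perm_combination (fun u v => (s u == v)%:R).
Proof.
exists (fun s' => (s' == s)%:R) => u v.
rewrite (bigD1 s) //= eqxx mul1r big1 ?addr0 // => s' /negPf ->.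
by rewrite mul0r.
Qed.

Lemma perm_combination_add t t' :
  perm_combination t -> perm_combination t' ->
  perm_combination (fun u v => t u v + t' u v).
Proof.
move=> [c ct] [c' ct']; exists (fun s => c s + c' s) => u v.
by rewrite ct ct' -big_split; apply: eq_bigr => s _; rewrite mulrDl.
Qed.

Lemma perm_combination_scale a t :
  perm_combination t -> perm_combination (fun u v => a * t u v).
Proof.
move=> [c ct]; exists (fun s => a * c s) => u v.
by rewrite ct mulr_sumr; apply: eq_bigr => s _; rewrite mulrA.
Qed.

Lemma perm_combination_sum (I : finType) (t : I -> A -> A -> K) :
  (forall i, perm_combination (t i)) ->
  perm_combination (fun u v => \sum_i t i u v).
Proof.
move=> /fin_all_exists[c ct]; exists (fun s => \sum_i c i s) => u v.
under eq_bigr do rewrite ct; rewrite exchange_big.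
by apply: eq_bigr => s _; rewrite mulr_suml.
Qed.

Lemma perm_combination_precomp (s : {perm A}) t :
  perm_combination t -> perm_combination (fun u v => t (s u) v).
Proof.
move=> [c ct]; exists (fun s' => c (s^-1 * s')%g) => u v.
rewrite ct (reindex_inj (mulgI s^-1%g)) /=.
by apply: eq_bigr => s' _; rewrite permM permK.
Qed.

Lemma perm_combination_id : perm_combination (fun u v => (u == v)%:R).
Proof.
by apply: (eq_perm_combination _ (perm_combination_perm 1)) => u v; rewrite perm1.
Qed.

Lemma sum_tperm y u v :
  \sum_a (tperm y a u == v)%:R
    = (u == y)%:R + (v == y)%:R + (q - 1) * (u == v)%:R
      - q * (u == y)%:R * (v == y)%:R :> K.
Proof.
have [->|neq_uy] := eqVneq u y.
  rewrite (eq_bigr (fun a => (a == v)%:R)) => [|a _]; last by rewrite tpermL.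
  rewrite (bigD1 v) //= eqxx big1 => [|a /negPf -> //].
  by rewrite [y == v]eq_sym; case: (v == y) => /=; ring.
rewrite (bigD1 u) //= tpermR (eq_bigr (fun=> (u == v)%:R)) => [|a neq_au].
  have q_gt0 : (0 < #|A|)%N by apply/card_gt0P; exists u.
  rewrite sumr_const cardC1 [v == y]eq_sym -[X in _ + X = _]mulr_natl.
  by rewrite -subn1 natrB //= -/q; ring.
by rewrite tpermD // eq_sym.
Qed.

(** Summing the matrices of all the transpositions (y a), trivial ones included,
    gives twice the all-one matrix up to a multiple of the identity. *)
Lemma perm_combination_one : perm_combination (fun _ _ => 1).
Proof.
apply: (@eq_perm_combination _ (fun u v => 2^-1 *
  (\sum_y \sum_a (tperm y a u == v)%:R + - (q * (q - 2)) * (u == v)%:R))).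
  move=> u v; under eq_bigr do rewrite sum_tperm.
  have d1 w : \sum_y (w == y)%:R = 1 :> K.
    by rewrite (bigD1 w) //= eqxx big1 ?addr0 // => a; rewrite eq_sym => /negPf ->.
  rewrite sumrB !big_split /= !d1 sumr_const.
  rewrite -[X in _ + X - _ + _]mulr_natl -[#|xpredT|%:R]/q.
  rewrite (eq_bigr (fun y => q * (u == v)%:R * (u == y)%:R)) => [|y _]; last first.
    have [->|neq_uy] := eqVneq u y; last by rewrite !mulr0 mul0r.
    by rewrite [y == v]eq_sym; ring.
  by rewrite -mulr_sumr d1; field.
apply: perm_combination_scale; apply: perm_combination_add.
  by do 2![apply: perm_combination_sum => ?]; apply: perm_combination_perm.
by apply: perm_combination_scale; apply: perm_combination_id.
Qed.

(** This matrix sends f to the multiple of u |-> q [u = b] - 1 by the number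
    q f(y) - \sum_v f(v), so for a suitable y it does not kill a given f that is
    not constant.  For b = y it is a combination of the sum of the transpositions
    (y a), the identity and the all-one matrix; the transposition (b y) then
    moves the first y to b. *)
Lemma perm_combination_rank1 b y :
  perm_combination
    (fun u v => (q * (u == b)%:R - 1) * (q * (v == y)%:R - 1)).
Proof.
pose t u v : K := (q * (u == y)%:R - 1) * (q * (v == y)%:R - 1).
apply: (@eq_perm_combination _ (fun u v => t (tperm b y u) v)) => [u v|].
  by rewrite /t (canF_eq (tpermK b y)) tpermR.
apply: perm_combination_precomp.
apply: (@eq_perm_combination _ (fun u v => - q * \sum_a (tperm y a u == v)%:R
  + (q * (q - 1) * (u == v)%:R + 1))).
  by move=> u v; rewrite sum_tperm /t; ring.
apply: perm_combination_add.
  apply: perm_combination_scale; apply: perm_combination_sum => a.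
  exact: perm_combination_perm.
apply: perm_combination_add; last exact: perm_combination_one.
by apply: perm_combination_scale; apply: perm_combination_id.
Qed.

End PermCombinations.

(** * Zonal functions and the span of an orbit *)

Section Orbit.

Variables (K : numFieldType) (n : nat) (A : finType).
Implicit Types (D : {set word n A}) (J : {set 'I_n}).

(** Expanding the product over the coordinates of the combinations of
    permutations gives a combination, indexed by the tuples of permutations, of
    translates of the characteristic vector of D. *)
Lemma tensor_orbit_span D (t : 'I_n -> A -> A -> K) :
  (forall i, perm_combination (t i)) ->
  [ffun x : word n A => \sum_(z in D) \prod_i t i (x i) (z i)]
    \in orbit_span K (wreath n A) D.
Proof.
move=> /fin_all_exists[c ct].
pose g p := ((wreath_perm 1 p)^-1)%g : {perm word n A}.
rewrite (_ : [ffun x => _] = \sum_(p : {ffun 'I_n -> {perm A}})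
    (\prod_i c i (p i)) *: fun_act (g p) (char_vec K D)).
  apply: memv_suml => p _; apply/memvZ/memv_span/image_f.
  by rewrite groupV; apply/imset2P; exists 1%g p; rewrite ?inE.
apply/ffunP=> x; rewrite sum_ffunE ffunE.
transitivity (\sum_(z in D) \sum_(p : {ffun 'I_n -> {perm A}})
    (\prod_i c i (p i)) * (wreath_perm 1 p x == z)%:R).
  apply: eq_bigr => z _; under eq_bigr do rewrite ct.
  rewrite bigA_distr_bigA; apply: eq_bigr => p _.
  rewrite big_split /=; congr (_ * _).
  rewrite permE; have [<-|neq] := eqVneq.
    by apply: big1 => i _; rewrite ffunE perm1 eqxx.
  have [i neqi] : exists i, p i (x i) != z i.
    apply/existsP; apply: contraR neq => /existsPn eqz.
    by apply/eqP/ffunP=> i; rewrite ffunE perm1; apply/eqP; rewrite -[_ == _]negbK.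
  by rewrite (bigD1 i) //= (negPf neqi) mul0r.
rewrite exchange_big; apply: eq_bigr => p _; rewrite !ffunE /g invgK -mulr_sumr.
congr (_ * _).
have [inD|notinD] := boolP (_ \in D).
  rewrite (bigD1 (wreath_perm 1 p x)) //= eqxx big1 ?addr0 // => z.
  by case/andP=> _; rewrite eq_sym => /negPf ->.
by rewrite big1 // => z zD; case: eqP notinD => // ->; rewrite zD.
Qed.

Let q : K := #|A|%:R.

Definition zonal J (b x : word n A) : K :=
  \prod_(i in J) (q * (x i == b i)%:R - 1).

Definition zonal_vec J b : {ffun word n A -> K^o} := [ffun x => zonal J b x].

(** The sum of the modules V_J for J in P. *)
Definition zonal_space (P : pred {set 'I_n}) : {vspace {ffun word n A -> K^o}} :=
  <<[seq zonal_vec p.1 p.2 | p : {set 'I_n} * word n A in [pred p | P p.1]]>>%VS.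

Lemma zonalC J b x : zonal J b x = zonal J x b.
Proof. by apply: eq_bigr => i _; rewrite eq_sym. Qed.

(** The zonal functions resolve the identity: this is the expansion of the
    product of the q [x_i = b_i] = 1 + (q [x_i = b_i] - 1). *)
Lemma sum_zonal b x : \sum_J zonal J b x = q ^+ n * (x == b)%:R.
Proof.
transitivity (\prod_i (q * (x i == b i)%:R - 1 + 1)).
  by rewrite bigA_distr; apply: eq_bigr => J _; rewrite /zonal big_mkcond.
under eq_bigr do rewrite subrK; rewrite big_split prodr_const /= card_ord.
congr (_ * _); have [<-|neq] := eqVneq; first by apply: big1 => i _; rewrite eqxx.
have [i neqi] : exists i, x i != b i.
  apply/existsP; apply: contraR neq => /existsPn eqz.
  by apply/eqP/ffunP=> i; apply/eqP; rewrite -[_ == _]negbK.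
by rewrite (bigD1 i) //= (negPf neqi) mul0r.
Qed.

(** The wreath product permutes the modules V_J as its permutations of the
    coordinates permute the sets J. *)
Lemma zonal_wreath J y s p z :
  zonal J y (wreath_perm s p z)
    = zonal (s @: J) [ffun k => (p (s^-1 k))^-1 (y (s^-1 k))]%g z.
Proof.
rewrite /zonal big_imset /=; last by move=> i j _ _; apply: perm_inj.
apply: eq_bigr => i _; rewrite permE !ffunE permK.
by rewrite (canF_eq (permK (p i))).
Qed.

Lemma mem_zonal_space (P : pred {set 'I_n}) J b :
  P J -> zonal_vec J b \in zonal_space P.
Proof. by move=> PJ; apply/memv_span/imageP; exists (J, b). Qed.

Lemma zonal_space_subv (P : pred {set 'I_n}) (U : {vspace {ffun word n A -> K^o}}) :
  (forall J b, P J -> zonal_vec J b \in U) -> (zonal_space P <= U)%VS.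
Proof. by move=> PU; apply/span_subvP=> _ /imageP[[J b] /= PJ ->]; apply: PU. Qed.

Lemma zonal_expansion (f : {ffun word n A -> K^o}) :
  q ^+ n *: f = \sum_J \sum_b f b *: zonal_vec J b.
Proof.
apply/ffunP=> x; rewrite sum_ffunE ffunE.
under eq_bigr do rewrite sum_ffunE; rewrite exchange_big /=.
under eq_bigr => b _.
  under eq_bigr do rewrite !ffunE; rewrite -mulr_sumr sum_zonal; over.
rewrite (bigD1 x) //= eqxx mulr1 big1 ?addr0 => [|b]; first by rewrite mulrC.
by rewrite eq_sym => /negPf ->; rewrite !mulr0.
Qed.

(** In zonal_expansion, the part indexed by J has at x the value
    \sum_b f b * zonal J x b, since zonal J is symmetric in its two words. *)
Lemma zonal_space_ortho (P : pred {set 'I_n}) (f : {ffun word n A -> K^o}) :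
  (0 < #|A|)%N ->
  (forall J x, ~~ P J -> \sum_b f b * zonal J x b = 0) -> f \in zonal_space P.
Proof.
move=> A_gt0 ortho.
have qn0 : q ^+ n != 0 by rewrite expf_neq0 // pnatr_eq0 -lt0n.
rewrite -(scalerK qn0 f) memvZ // zonal_expansion memv_suml // => J _.
have [PJ|nPJ] := boolP (P J).
  by apply: memv_suml => b _; apply/memvZ/mem_zonal_space.
rewrite (_ : \sum_b _ = 0) ?mem0v //; apply/ffunP=> x.
rewrite sum_ffunE [RHS]ffunE -[RHS](ortho J x nPJ).
by apply: eq_bigr => b _; rewrite !ffunE zonalC.
Qed.

(** Irreducibility of the modules V_J, in an explicit form: once the orbit of
    1_D is not orthogonal to V_J, its span contains all of V_J. *)
Lemma zonal_orbit_span D J y :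
  \sum_(z in D) zonal J y z != 0 ->
  forall b, zonal_vec J b \in orbit_span K (wreath n A) D.
Proof.
move=> nz b; pose t i u v : K :=
  if i \in J then (q * (u == b i)%:R - 1) * (q * (v == y i)%:R - 1) else 1.
have /(tensor_orbit_span D) : forall i, perm_combination (t i).
  rewrite /t => i; case: (i \in J); first exact: perm_combination_rank1.
  exact: perm_combination_one.
set f := [ffun x => _]; suff -> : f = (\sum_(z in D) zonal J y z) *: zonal_vec J b.
  by move/(memvZ (\sum_(z in D) zonal J y z)^-1); rewrite scalerK.
apply/ffunP=> x; rewrite !ffunE [RHS]mulr_suml; apply: eq_bigr => z _.
by rewrite mulrC /zonal -big_split [RHS]big_mkcond.
Qed.

Lemma orbit_span_zonal D (P : pred {set 'I_n}) :
  (0 < #|A|)%N -> (forall (s : 'S_n) J, P (s @: J) = P J) ->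
  (forall J, P J -> exists y, \sum_(z in D) zonal J y z != 0) ->
  (forall J y, ~~ P J -> \sum_(z in D) zonal J y z = 0) ->
  orbit_span K (wreath n A) D = zonal_space P.
Proof.
move=> A_gt0 symP nzP zP; apply/eqP; rewrite eqEsubv; apply/andP; split.
  apply/span_subvP=> _ /imageP[g /imset2P[s p _ _ ->] ->].
  apply: zonal_space_ortho => // J x nPJ.
  rewrite (reindex_inj (@perm_inj _ (wreath_perm s p))) /=.
  under eq_bigr do rewrite !ffunE permK zonal_wreath.
  rewrite -[RHS](zP (s @: J) [ffun k => (p (s^-1 k))^-1 (x (s^-1 k))]%g) ?symP //.
  rewrite [RHS]big_mkcond; apply: eq_bigr => z _.
  by case: (z \in D); rewrite ?mul1r ?mul0r.
by apply: zonal_space_subv => J b /nzP[y nz]; apply: zonal_orbit_span nz b.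
Qed.

End Orbit.

(** * Orthogonal arrays *)

Lemma between_set_card (I : finType) (S B : {set I}) (k : nat) :
  S \subset B -> (#|S| <= k <= #|B|)%N ->
  exists T : {set I}, [/\ S \subset T, T \subset B & #|T| = k].
Proof.
move=> sSB /andP[leSk lekB].
pose T0 := [set x in take (k - #|S|) (enum (B :\: S))].
have sT0 : T0 \subset B :\: S.
  by apply/subsetP=> x; rewrite inE => /mem_take; rewrite mem_enum.
exists (S :|: T0); split; first exact: subsetUl.
  by rewrite subUset sSB (subset_trans sT0) // subsetDl.
have -> : #|S :|: T0| = (#|S| + #|T0|)%N.
  apply/eqP; rewrite (leq_card_setU S T0) disjoint_sym.
  by move: sT0; rewrite subsetD => /andP[].
rewrite cardsE (card_uniqP _) ?take_uniq ?enum_uniq // size_takel ?subnKC //.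
by rewrite -cardE cardsD (setIidPr sSB) leq_sub2r.
Qed.

Section OrthogonalArrays.

Variables (K : numFieldType) (n : nat) (A : finType) (t lambda : nat).
Variable D : {set word n A}.
Hypotheses (le_tn : (t <= n)%N) (A_gt0 : (0 < #|A|)%N).
Hypothesis oaD : orthogonal_array t lambda D.
Implicit Types (S T J : {set 'I_n}) (x y z w : word n A).

Let q : K := #|A|%:R.

Let q_gt0 : 0 < q. Proof. by rewrite ltr0n. Qed.
Let q_ge1 : 1 <= q. Proof. by rewrite ler1n. Qed.

Definition agree S y z : K := \prod_(i in S) (z i == y i)%:R.

Lemma agreeC S y z : agree S y z = agree S z y.
Proof. by apply: eq_bigr => i _; rewrite eq_sym. Qed.

Lemma agreeE S y z : agree S y z = [forall i in S, z i == y i]%:R.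
Proof.
rewrite /agree; have [/forall_inP eqS|] := boolP [forall i in S, z i == y i].
  by apply: big1 => i iS; rewrite eqS.
by case/forall_inPn=> i iS /negPf neq; rewrite (bigD1 i) //= neq mul0r.
Qed.

Lemma agree_ge0 S y z : 0 <= agree S y z.
Proof. by rewrite agreeE ler0n. Qed.

Lemma sum_agree S y : \sum_z agree S y z = q ^+ (n - #|S|).
Proof.
under eq_bigr do rewrite /agree big_mkcond /=.
rewrite -(bigA_distr_bigA (fun i a => if i \in S then (a == y i)%:R else 1)) /=.
rewrite (eq_bigr (fun i => if i \in ~: S then q else 1)) => [|i _].
  rewrite -big_mkcond prodr_const cardsCs setCK card_ord //.
rewrite inE; case: (i \in S) => /=; last by rewrite sumr_const.
by rewrite (bigD1 (y i)) //= eqxx big1 ?addr0 // => a /negPf ->.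
Qed.

Lemma sum_oa_agree T y : #|T| = t -> \sum_(z in D) agree T y z = lambda%:R.
Proof.
move=> cardT.
have szT : size (enum T) == t by rewrite -cardE cardT.
pose pos := Tuple szT; case: oaD => _ /(_ pos (enum_uniq _) (map_tuple y pos)) <-.
under eq_bigr do rewrite agreeE.
rewrite -natr_sum -sum1_card (eq_bigl _ _ (in_set _)) big_mkcondr /=.
congr (_%:R); apply: eq_bigr => z _.
congr nat_of_bool; apply/forall_inP/forallP => [eqT k|eqT i iT].
  by rewrite tnth_map eqT // -mem_enum mem_tnth.
have /tnthP[k ->] : i \in pos by rewrite mem_enum.
by have := eqT k; rewrite tnth_map.
Qed.

(** Orthogonal arrays as quadrature rules: count the pairs of a word of D and an
    arbitrary word that agree on T, in two ways. *)
Lemma oa_exact T (g : word n A -> K) :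
  #|T| = t -> (forall z w, {in T, z =1 w} -> g z = g w) ->
  q ^+ (n - t) * \sum_(z in D) g z = lambda%:R * \sum_z g z.
Proof.
move=> cardT gT; rewrite !mulr_sumr -cardT.
under eq_bigr => z _ do rewrite -(sum_agree T z) mulr_suml.
rewrite exchange_big; apply: eq_bigr => w _ /=.
rewrite -(sum_oa_agree w cardT) mulr_suml; apply: eq_bigr => z _.
rewrite [agree T w z]agreeC !agreeE.
have [/forall_inP eqT|_] := boolP [forall i in T, w i == z i]; last by rewrite !mul0r.
by rewrite (gT z w) // => i iT; apply/eqP; rewrite eq_sym eqT.
Qed.

(** If |S| <= t, the number of words of D that agree with y on S is exactly
    lambda q^(t - |S|); otherwise it is at most lambda, the number of those that
    agree with y on a t-subset of S. *)
Lemma sum_oa_agree_le S y :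
  0 <= q ^+ #|S| * \sum_(z in D) agree S y z <= lambda%:R * q ^+ maxn #|S| t.
Proof.
rewrite mulr_ge0 ?exprn_ge0 ?(ltW q_gt0) ?sumr_ge0 //=; last first.
  by move=> z _; apply: agree_ge0.
have [leSt|/ltnW letS] := leqP #|S| t.
  have [|T [sST _ cardT]] := between_set_card (subsetT S) (k := t).
    by rewrite leSt cardsT card_ord.
  have qnt : 0 < q ^+ (n - t) by rewrite exprn_gt0.
  rewrite -(ler_pM2l qnt) mulrCA (oa_exact cardT) => [|z w eqT].
    rewrite sum_agree !(mulrCA _ lambda%:R) -!exprD.
    by rewrite subnKC ?subnK // (leq_trans leSt).
  by apply: eq_bigr => i iS; rewrite eqT // (subsetP sST).
have [|T [_ sTS cardT]] := between_set_card (sub0set S) (k := t).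
  by rewrite cards0.
rewrite mulrC ler_pM2r ?exprn_gt0 // -(sum_oa_agree y cardT).
apply: ler_sum => z _; rewrite !agreeE ler_nat.
case: forall_inP => // eqS; case: forall_inP => // -[] i iT.
by rewrite eqS // (subsetP sTS).
Qed.

Lemma sum_zonal_all J y : J != set0 -> \sum_z zonal K J y z = 0.
Proof.
case/set0Pn=> i iJ; under eq_bigr do rewrite /zonal big_mkcond /=.
rewrite -(bigA_distr_bigA (fun i a =>
  if i \in J then #|A|%:R * (a == y i)%:R - 1 else 1)) /=.
rewrite (bigD1 i) //= iJ sumrB -mulr_sumr (bigD1 (y i)) //= eqxx.
rewrite big1 => [|a /negPf -> //]; rewrite sumr_const addr0 mulr1.
by rewrite subrr mul0r.
Qed.

Lemma sum_oa_zonal0 J y :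
  (0 < #|J| <= t)%N -> \sum_(z in D) zonal K J y z = 0.
Proof.
case/andP=> J_gt0 leJt.
have [|T [sJT _ cardT]] := between_set_card (subsetT J) (k := t).
  by rewrite leJt cardsT card_ord.
have qnt : q ^+ (n - t) != 0 by rewrite expf_neq0 // lt0r_neq0.
apply: (mulfI qnt); rewrite (oa_exact cardT) => [|z w eqT].
  by rewrite sum_zonal_all -?card_gt0 // !mulr0.
by apply: eq_bigr => i iJ; rewrite eqT // (subsetP sJT).
Qed.

Lemma zonal_agree J y z :
  zonal K J y z
    = \sum_(S in powerset J) (-1) ^+ #|J :\: S| * (q ^+ #|S| * agree S y z).
Proof.
transitivity (\prod_i ((if i \in J then q * (z i == y i)%:R else 0)
                       + (if i \in J then -1 else 1))).
  by rewrite /zonal big_mkcond; apply: eq_bigr => i _; case: ifP; rewrite ?add0r.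
rewrite bigA_distr [RHS]big_mkcond; apply: eq_bigr => S _; rewrite powersetE.
have [sSJ|/subsetPn[i iS /negPf niJ]] := boolP (S \subset J); last first.
  by rewrite (bigD1 i) //= iS niJ mul0r.
rewrite -!prodr_const -big_split /= mulrC.
rewrite [X in _ = X * _]big_mkcond [X in _ = _ * X]big_mkcond -big_split /=.
apply: eq_bigr => i _; rewrite inE.
have [iS|] := boolP (i \in S); first by rewrite (subsetP sSJ) ?mulr1.
by rewrite mul1r.
Qed.

(** The term S = J of the expansion zonal_agree is at least q^|J|, since y itself
    is counted; as |J| > t, the other 2^|J| - 1 terms are bounded by
    lambda q^(|J| - 1) in absolute value. *)
Lemma sum_oa_zonal_gt0 J y :
  (0 < lambda)%N -> (2 ^ n * lambda <= #|A|)%N ->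
  y \in D -> (t < #|J|)%N -> 0 < \sum_(z in D) zonal K J y z.
Proof.
move=> lambda_gt0 le_q yD lt_tJ.
under eq_bigr do rewrite zonal_agree.
rewrite exchange_big /= (bigD1 J) ?powersetE //= setDv cards0.
under eq_bigr do rewrite mul1r; rewrite -mulr_sumr.
set e := q ^+ #|J|.-1.
have J_gt0 : (0 < #|J|)%N by apply: leq_ltn_trans lt_tJ.
have e_gt0 : 0 < e by rewrite exprn_gt0.
have eJ : q ^+ #|J| = q * e by rewrite -exprS prednK //.
have lo : q * e <= q ^+ #|J| * \sum_(z in D) agree J y z.
  rewrite eJ ler_peMr ?(mulr_ge0 (ltW q_gt0)) ?(ltW e_gt0) // (bigD1 y) //= agreeE.
  have -> : [forall i in J, y i == y i] by apply/forall_inP.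
  by rewrite lerDl sumr_ge0 // => z _; apply: agree_ge0.
have hi : - (lambda%:R * e) *+ (2 ^ #|J| - 1) <=
   \sum_(S in powerset J | S != J) \sum_(z in D)
      (-1) ^+ #|J :\: S| * (q ^+ #|S| * agree S y z).
  rewrite -[(2 ^ _)%N]card_powerset (cardsD1 J) powersetE subxx add1n subn1 /=.
  rewrite -sumr_const [X in X <= _](eq_bigl (fun S => (S \in powerset J) && (S != J))).
    apply: ler_sum => S /andP[]; rewrite powersetE => sSJ neSJ.
    have ltSJ : (#|S| < #|J|)%N by rewrite proper_card // properEneq neSJ.
    have /andP[ge0 le] := sum_oa_agree_le S y.
    have le' : q ^+ #|S| * \sum_(z in D) agree S y z <= lambda%:R * e.
      apply: le_trans le _; rewrite ler_pM2l ?ltr0n // ler_weXn2l //.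
      by rewrite -ltnS prednK // gtn_max ltSJ.
    rewrite -!mulr_sumr -signr_odd; case: odd; rewrite ?expr1 ?expr0.
      by rewrite mulN1r lerN2.
    by rewrite mul1r (le_trans _ ge0) // oppr_le0 mulr_ge0 ?ler0n ?ltW.
  by move=> S; rewrite !inE andbC.
have {}le_q : (2 ^ #|J| * lambda)%:R <= q.
  rewrite ler_nat (leq_trans _ le_q) // leq_mul2r leq_pexp2l ?orbT //.
  by rewrite -[n in (_ <= n)%N]card_ord max_card.
apply: lt_le_trans (lerD lo hi).
have -> : q * e + - (lambda%:R * e) *+ (2 ^ #|J| - 1)
          = (q - ((2 ^ #|J| - 1) * lambda)%:R) * e.
  by rewrite mulNrn -[in LHS]mulr_natl natrM; ring.
rewrite mulr_gt0 // subr_gt0 (lt_le_trans _ le_q) // ltr_nat ltn_pmul2r //.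
by rewrite subn1 ltn_predL expn_gt0.
Qed.

End OrthogonalArrays.

(** * The modules generated by an orthogonal array *)

Definition zero_or_above (n t : nat) : pred {set 'I_n} :=
  [pred J : {set 'I_n} | (#|J| == 0) || (t < #|J|)]%N.

Lemma orbit_span_oa (K : numFieldType) (n t lambda : nat) (A : finType)
    (D : {set word n A}) :
  (t <= n)%N -> (0 < lambda)%N -> (2 ^ n * lambda <= #|A|)%N ->
  orthogonal_array t lambda D ->
  orbit_span K (wreath n A) D = zonal_space K A (zero_or_above t).
Proof.
move=> le_tn lambda_gt0 le_q oaD.
have A_gt0 : (0 < #|A|)%N.
  by apply: leq_trans le_q; rewrite muln_gt0 expn_gt0.
have /set0Pn[y yD] : D != set0 by case: oaD.
apply: orbit_span_zonal => // [s J|J|J z]; rewrite /zero_or_above /=.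
- by rewrite card_imset //; apply: perm_inj.
- case/orP=> [/eqP/cards0_eq->|lt_tJ]; exists y.
    under eq_bigr do rewrite /zonal big_set0.
    by rewrite sumr_const pnatr_eq0 -lt0n; apply/card_gt0P; exists y.
  by rewrite lt0r_neq0 // (sum_oa_zonal_gt0 _ le_tn A_gt0 oaD).
- rewrite negb_or -lt0n -leqNgt => cardJ.
  exact: (sum_oa_zonal0 _ le_tn A_gt0 oaD).
Qed.

(** * Words with a given support *)

Section Supports.

Variables (F : finFieldType) (n : nat).
Implicit Types (eta b x : word n F) (J : {set 'I_n}).

Definition supp eta : {set 'I_n} := [set i | eta i != 0].

(** A choice of a nonzero letter at each position of J is a word with support J:
    the letter 0 is the only choice at the other positions. *)
Lemma prod_sum_supp (R : comNzRingType) J (g : 'I_n -> F -> R) :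
  \prod_(i in J) \sum_(c | c != 0) g i c
    = \sum_(eta | supp eta == J) \prod_(i in J) g i (eta i).
Proof.
rewrite big_mkcond /=.
transitivity (\prod_i \sum_(c | (c != 0) == (i \in J))
                 if i \in J then g i c else 1).
  apply: eq_bigr => i _; case: (i \in J).
    by apply: eq_bigl => c; rewrite eqb_id.
  by rewrite (big_pred1 0) // => c; rewrite eqbF_neg negbK.
rewrite bigA_distr_big_dep /=; apply: eq_big => [eta|eta _]; last first.
  by rewrite -big_mkcond.
apply/familyP/eqP => [fam|<- i]; last by rewrite unfold_in inE eqxx.
by apply/setP=> i; rewrite inE; have := fam i; rewrite unfold_in => /eqP.
Qed.

Lemma card_supp J : #|[set eta | supp eta == J]|%:Z = (#|F|%:Z - 1) ^+ #|J|.
Proof.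
transitivity (\sum_(eta | supp eta == J) \prod_(i in J) (1 : int)).
  by rewrite big1_eq sumr_const cardsE natz.
rewrite -(prod_sum_supp J (fun _ _ => 1)) sumr_const cardC1 prodr_const.
congr (_ ^+ _); have F_gt0 : (0 < #|F|)%N by apply/card_gt0P; exists 0.
by rewrite -subn1 natrB // natz.
Qed.

Lemma card_wt j :
  #|[set eta : word n F | wt eta == j]|%:Z = 'C(n, j)%:Z * (#|F|%:Z - 1) ^+ j.
Proof.
have -> : #|[set eta : word n F | wt eta == j]|%:Z
    = \sum_(J : {set 'I_n} | #|J| == j) #|[set eta | supp eta == J]|%:Z.
  rewrite -!natz -sum1_card natr_sum (partition_big supp (fun J => #|J| == j)) /=.
    apply: eq_bigr => J /eqP cardJ; rewrite -natz -sum1_card natr_sum.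
    apply: eq_bigl => eta; rewrite !inE andb_idl // => /eqP suppJ.
    by rewrite /wt -/(supp eta) suppJ cardJ.
  by move=> eta; rewrite inE.
under eq_bigr => J /eqP cardJ do rewrite card_supp cardJ.
rewrite sumr_const -mulr_natl natz; congr (_%:Z * _).
by rewrite -[n in RHS]card_ord -card_draws cardsE.
Qed.

End Supports.

(** * Dimensions *)

Section ZonalDimension.

Variables (K : numFieldType) (F : finFieldType) (n : nat).
Implicit Types (eta b x : word n F) (J : {set 'I_n}).

Let q : K := #|F|%:R.

(** The functions x |-> q [x = c] - 1 on F add up to zero, so those with c != 0
    express the one with c = 0; take the product over the positions of J. *)
Lemma zonal_basis J b x :
  zonal K J b x = \sum_(eta | supp eta == J)
    (\prod_(i in J) ((b i == eta i)%:R - (b i == 0)%:R)) * zonal K J eta x.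
Proof.
under [RHS]eq_bigr do rewrite -big_split /=.
rewrite -(prod_sum_supp J (fun i c => ((b i == c)%:R - (b i == 0)%:R) *
  (#|F|%:R * (x i == c)%:R - 1))).
apply: eq_bigr => i _; have [->|b_neq0] := eqVneq (b i) 0; last first.
  rewrite (bigD1 (b i)) //= eqxx subr0 mul1r big1 ?addr0 // => c /andP[_ ne].
  by rewrite eq_sym (negPf ne) subr0 mul0r.
rewrite (eq_bigr (fun c => 1 - q * (x i == c)%:R)) => [|c c_neq0]; last first.
  by rewrite eq_sym (negPf c_neq0) sub0r mulN1r opprB.
have : \sum_c (1 - q * (x i == c)%:R) = 0.
  rewrite sumrB sumr_const -mulr_sumr (bigD1 (x i)) //= eqxx big1 => [|c].
    by rewrite addr0 mulr1 subrr.
  by rewrite eq_sym => /negPf ->.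
rewrite (bigD1 0) //= => /eqP; rewrite addrC addr_eq0 => /eqP ->.
by rewrite opprB.
Qed.

Lemma dimv_ffun : \dim {:{ffun word n F -> K^o}} = (#|F| ^ n)%N.
Proof.
by rewrite dimvf /dim /= card_ffun card_ord muln1. Qed.

(** The number of words with support in P bounds the dimension by zonal_basis.
    The same bound holds for the complement of P, and the two bounds add up to
    the dimension of the whole space, which the two spaces generate: so both are
    equalities. *)
Lemma dim_zonal_space (P : pred {set 'I_n}) :
  \dim (zonal_space K F P) = #|[set eta : word n F | P (supp eta)]|.
Proof.
have le Q : (\dim (zonal_space K F Q) <= #|[set eta : word n F | Q (supp eta)]|)%N.
  pose X := [seq zonal_vec K (supp eta) eta | eta in [set eta | Q (supp eta)]].
  have /dimvS/leq_trans : (zonal_space K F Q <= <<X>>)%VS.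
    apply: zonal_space_subv => J b QJ.
    rewrite (_ : zonal_vec K J b = \sum_(eta | supp eta == J)
        (\prod_(i in J) ((b i == eta i)%:R - (b i == 0)%:R)) *: zonal_vec K J eta).
      apply: memv_suml => eta /eqP suppJ; apply/memvZ/memv_span/imageP.
      by exists eta; rewrite ?inE ?suppJ.
    apply/ffunP=> x; rewrite sum_ffunE ffunE zonal_basis.
    by apply: eq_bigr => eta _; rewrite !ffunE.
  by apply; rewrite (leq_trans (dim_span _)) // size_image.
have full : (fullv <= zonal_space K F P + zonal_space K F (predC P))%VS.
  apply/subvP=> f _.
  have qn0 : q ^+ n != 0.
    by rewrite expf_neq0 // pnatr_eq0 -lt0n; apply/card_gt0P; exists 0.
  rewrite -(scalerK qn0 f) memvZ // zonal_expansion.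
  apply: memv_suml => J _; apply: memv_suml => b _; apply: memvZ.
  have [PJ|nPJ] := boolP (P J).
    by apply: (subvP (addvSl _ _)); apply: mem_zonal_space.
  by apply: (subvP (addvSr _ _)); apply: mem_zonal_space.
apply/eqP; rewrite eqn_leq le /=.
have := leq_trans (dimvS full) (dimv_add_leqif _ _).1.
rewrite dimv_ffun => /leq_trans/(_ (leq_add (leqnn _) (le (predC P)))).
have -> : [set eta : word n F | predC P (supp eta)] = ~: [set eta | P (supp eta)].
  by apply/setP=> eta; rewrite !inE.
by rewrite -{1}[n]card_ord -card_ffun -(cardsC [set eta | P (supp eta)]) leq_add2r.
Qed.

End ZonalDimension.

(** * Counting words by weight *)

Lemma card_wt_range (F : finFieldType) (n a b : nat) :
  #|[set eta : word n F | a <= wt eta < b]%N|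
    = (\sum_(a <= j < b) #|[set eta : word n F | wt eta == j]|)%N.
Proof.
under [RHS]eq_bigr do rewrite -sum1_card big_mkcond.
rewrite exchange_big -sum1_card big_mkcond; apply: eq_bigr => eta _ /=.
rewrite inE -(big_nat1_eq addn (fun=> 1%N)) big_mkcond /=.
by apply: eq_bigr => j _; rewrite inE eq_sym.
Qed.

Lemma card_zero_or_above (F : finFieldType) (n t : nat) :
  #|[set eta : word n F | zero_or_above t (supp eta)]|
    = (#|[set eta : word n F | wt eta == 0]|
       + #|[set eta : word n F | t.+1 <= wt eta < n.+1]|)%N.
Proof.
rewrite (_ : [set eta | _] = [set eta : word n F | wt eta == 0%N]
    :|: [set eta : word n F | t.+1 <= wt eta < n.+1]%N).
  apply/eqP; rewrite (leq_card_setU _ _) -setI_eq0; apply/eqP/setP=> eta.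
  by rewrite !inE; case: (wt eta).
have wt_le (eta : word n F) : (wt eta <= n)%N.
  by rewrite -[leqRHS]card_ord max_card.
by apply/setP=> eta; rewrite /zero_or_above !inE ltnS wt_le andbT.
Qed.

Lemma card_zero_or_above_compl (F : finFieldType) (n t : nat) :
  #|[set eta : word n F | zero_or_above t (supp eta)]|%:Z
    = #|F|%:Z ^+ n - \sum_(1 <= j < t.+1) 'C(n, j)%:Z * (#|F|%:Z - 1) ^+ j.
Proof.
have := cardsC [set eta : word n F | zero_or_above t (supp eta)].
rewrite card_ffun card_ord.
rewrite (_ : ~: _ = [set eta : word n F | 1 <= wt eta < t.+1]%N); last first.
  by apply/setP=> eta; rewrite !inE /= negb_or -lt0n -leqNgt.
rewrite card_wt_range => /(congr1 (fun m : nat => m%:Z)).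
rewrite PoszD -[in RHS]natz natrX natz => <-.
rewrite -[X in _ + X - _]natz natr_sum -addrA -sumrB big1 ?addr0 // => j _.
by rewrite natz card_wt subrr.
Qed.

(** * Characters and weight spaces *)

Section WeightSpaces.

Variables (K : numFieldType) (F : finFieldType) (n : nat) (psi : F -> K).
Hypotheses (psi_add : additive_character psi) (psi_nt : nontrivial psi).
Implicit Types (eta b x : word n F) (J : {set 'I_n}).

Let q : K := #|F|%:R.

Lemma additive_character0 : psi 0 = 1.
Proof.
case: psi_add => psi_neq0 psiD; apply: (mulfI (psi_neq0 0)).
by rewrite -psiD addr0 mulr1.
Qed.

Lemma sum_additive_character a : \sum_c psi (c * a) = q * (a == 0)%:R.
Proof.
case: psi_add => psi_neq0 psiD; have [->|a_neq0] := eqVneq a 0.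
  under eq_bigr do rewrite mulr0 additive_character0.
  by rewrite sumr_const mulr1.
have -> : \sum_c psi (c * a) = \sum_c psi c.
  by rewrite [RHS](reindex_inj (mulIf a_neq0)).
case: psi_nt => x psix; apply/eqP; rewrite mulr0.
have : (psi x - 1) * \sum_c psi c == 0.
  rewrite mulrBl mul1r subr_eq0 mulr_sumr [eqbRHS](reindex_inj (addrI x)) /=.
  by apply/eqP/eq_bigr => c _; rewrite psiD.
by rewrite mulf_eq0 subr_eq0 (negPf psix).
Qed.

(** Orthogonality of characters writes q [x_i = b_i] - 1 as the sum of
    psi (c (x_i - b_i)) over c != 0; the product over J runs over the characters
    with support J. *)
Lemma zonal_chi J b x :
  zonal K J b x
    = \sum_(eta | supp eta == J) psi (- dotp eta b) * psi (dotp eta x).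
Proof.
have [_ psiD] := psi_add.
transitivity (\prod_(i in J) \sum_(c | c != 0) psi (c * (x i - b i))).
  apply: eq_bigr => i _; apply/eqP; rewrite subr_eq.
  rewrite -subr_eq0 -[x i == b i]subr_eq0 -sum_additive_character.
  by rewrite (bigD1 0) //= mul0r additive_character0 addrC subrr.
rewrite prod_sum_supp; apply: eq_bigr => eta /eqP <-.
rewrite -psiD /dotp -sumrN -big_split /= (big_morph psi psiD additive_character0).
rewrite big_mkcond; apply: eq_bigr => i _; rewrite inE mulrBr addrC.
by case: eqVneq => // ->; rewrite !mul0r subrr additive_character0.
Qed.

(** One inclusion is zonal_chi; the other follows because weight_space is spanned
    by no more vectors than the dimension of the zonal space. *)
Lemma weight_space_zonal j :
  weight_space n psi j = zonal_space K F [pred J : {set 'I_n} | #|J| == j].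
Proof.
have sub : (zonal_space K F [pred J : {set 'I_n} | #|J| == j]
            <= weight_space n psi j)%VS.
  apply: zonal_space_subv => J b /eqP cardJ.
  rewrite (_ : zonal_vec K J b = \sum_(eta | supp eta == J)
                                   psi (- dotp eta b) *: chi psi eta).
    apply: memv_suml => eta /eqP suppJ; apply/memvZ/memv_span/imageP.
    by exists eta; rewrite // inE /wt -/(supp eta) suppJ cardJ.
  apply/ffunP=> x; rewrite sum_ffunE ffunE zonal_chi.
  by apply: eq_bigr => eta _; rewrite !ffunE.
apply/esym/eqP; rewrite eqEdim sub dim_zonal_space.
by rewrite (leq_trans (dim_span _)) // size_image.
Qed.

Lemma dim_weight_space j :
  \dim (weight_space n psi j) = #|[set eta : word n F | wt eta == j]|.
Proof. by rewrite weight_space_zonal dim_zonal_space. Qed.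

Lemma weight_space_sum t :
  zonal_space K F (@zero_or_above n t)
    = (weight_space n psi 0 + \sum_(t.+1 <= j < n.+1) weight_space n psi j)%VS.
Proof.
apply/eqP; rewrite eqEsubv; apply/andP; split.
  apply: zonal_space_subv => J b /orP[J0|lt_tJ].
    apply: (subvP (addvSl _ _)); rewrite weight_space_zonal.
    exact: mem_zonal_space.
  apply: (subvP (addvSr _ _)).
  have cardJ : #|J| \in index_iota t.+1 n.+1.
    by rewrite mem_index_iota lt_tJ ltnS -[n in (_ <= n)%N]card_ord max_card.
  rewrite (big_rem _ cardJ) /=; apply: (subvP (addvSl _ _)).
  by rewrite weight_space_zonal mem_zonal_space /=.
have sub (P Q : pred {set 'I_n}) :
    subpred P Q -> (zonal_space K F P <= zonal_space K F Q)%VS.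
  by move=> PQ; apply: zonal_space_subv => J b /PQ QJ; apply: mem_zonal_space.
rewrite subv_add weight_space_zonal sub => [/=|J /= J0]; last first.
  by rewrite /zero_or_above /= J0.
rewrite big_seq; elim/big_ind: _ => [||j]; first exact: sub0v.
  by move=> U V sU sV; rewrite subv_add sU.
rewrite mem_index_iota weight_space_zonal => /andP[lt_tj _].
by apply: sub => J /= /eqP cardJ; rewrite /zero_or_above /= cardJ lt_tj orbT.
Qed.

(** The dimensions of the summands and of the sum count the same words. *)
Lemma weight_space_direct t :
  directv (weight_space n psi 0
           + \sum_(t.+1 <= j < n.+1) weight_space n psi j).
Proof.
rewrite directvE /= -weight_space_sum dim_zonal_space card_zero_or_above.
by rewrite dim_weight_space card_wt_range; under eq_bigr do rewrite -dim_weight_space.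
Qed.

End WeightSpaces.

(** * The span of the orbit of an orthogonal array *)

Theorem theorem4p4 (n t lambda : nat) (lt_tn : (t < n)%N)
    (lambda_gt0 : (1 <= lambda)%N) :
  exists q0 : nat,
  forall (F : finFieldType) (D : {set {ffun 'I_n -> F}}),
    (q0 <= #|F|)%N -> orthogonal_array t lambda D ->
    (forall (R : realType) (psi : F -> complex R),
       additive_character psi -> nontrivial psi ->
       orbit_span (complex R) (wreath n F) D
         = (weight_space n psi 0 +
            \sum_(t.+1 <= j < n.+1) weight_space n psi j)%VS
       /\ directv (weight_space n psi 0 +
            \sum_(t.+1 <= j < n.+1) weight_space n psi j)%VS)
    /\
    (\dim (orbit_span rat (wreath n F) D))%:Z
      = #|F|%:Z ^+ n - \sum_(1 <= j < t.+1) 'C(n, j)%:Z * (#|F|%:Z - 1) ^+ j.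
Proof.
exists (2 ^ n * lambda)%N => F D le_q oaD; split=> [R psi psi_add psi_nt|].
  split; last exact: weight_space_direct psi_add psi_nt t.
  rewrite (orbit_span_oa _ (ltnW lt_tn) lambda_gt0 le_q oaD).
  exact: weight_space_sum psi_add psi_nt t.
rewrite (orbit_span_oa _ (ltnW lt_tn) lambda_gt0 le_q oaD).
by rewrite dim_zonal_space card_zero_or_above_compl.
Qed.
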